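(* Let $d\in\mathbb{N}$. For every $\alpha\in[0,d)$ there exists a non-empty compact set $K\subset\mathbb{R}^d$ with $\dim_{\mathrm{A}} K=\alpha$ such that every microset $E\in\mathcal{G}_K$ satisfies $\dim_{\mathrm{ML}} E=0$.
   Context: $B(x,r)$ denotes the closed ball of centre $x$ and radius $r$, and $N_r(F)$ denotes the minimal number of closed balls of radius $r$ centred in $F$ needed to cover $F$. For a non-empty compact $K\subset\mathbb{R}^d$, a miniset of $K$ is a non-empty compact set of the form $\lambda(K-x)\cap B(0,1)$ with $x\in K$ and $\lambda\geq1$; a microset of $K$ is any limit, in the Hausdorff metric, of a sequence of minisets of $K$; $\mathcal{G}_K$ denotes the set of microsets of $K$. The Assouad dimension is $\dim_{\mathrm{A}} K=\inf\{\alpha>0:\exists C>0\ \forall 0<r\leq R<1\ \forall x\in K,\ N_r(B(x,R)\cap K)\leq C(R/r)^\alpha\}$. The lower dimension of a non-empty set $F$ is $\dim_{\mathrm{L}} F=\sup\{\alpha>0:\exists C>0\ \forall 0<r\leq R<1\ \forall x\in F,\ N_r(B(x,R)\cap F)\geq C(R/r)^\alpha\}$ (with $\sup\varnothing=0$). The modified lower dimension is $\dim_{\mathrm{ML}} E=\sup\{\dim_{\mathrm{L}} F:\varnothing\neq F\subset E\}$. *)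

(* Defs.v *)
From HB Require Import structures.
From mathcomp Require Import all_boot all_order all_algebra.
From mathcomp Require Import all_classical all_reals all_analysis.
Set Implicit Arguments. Unset Strict Implicit. Unset Printing Implicit Defensive.
Import Order.TTheory GRing.Theory Num.Theory.
Import numFieldNormedType.Exports.
Local Open Scope classical_set_scope.
Local Open Scope ring_scope.

Section Defs.
Context {R : realType} {d : nat}.
Notation pt := 'rV[R]_d.

Definition edist (x y : pt) : R := Num.sqrt (\sum_(i < d) (x ord0 i - y ord0 i) ^+ 2).

Definition cball (x : pt) (r : R) : set pt := [set y | edist x y <= r].

Definition rcover (r : R) (F : set pt) (s : seq pt) : Prop :=
  (forall c, c \in s -> F c) /\
  (F `<=` [set y | exists2 c, c \in s & cball c r y]).

(* N_r(F) : minimal number of closed r-balls centred in F covering F (+oo if none) *)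
Definition Ncov (r : R) (F : set pt) : \bar R :=
  ereal_inf [set ((size s)%:R)%:E | s in [set s | rcover r F s]].

Definition assouad_cond (K : set pt) (a : R) : Prop :=
  exists C : R, 0 < C /\
    forall r Rr x, 0 < r -> r <= Rr -> Rr < 1 -> K x ->
      (Ncov r (cball x Rr `&` K) <= (C * (Rr / r) `^ a)%:E)%E.

Definition dimA (K : set pt) : \bar R :=
  ereal_inf [set a%:E | a in [set a : R | 0 < a /\ assouad_cond K a]].

Definition lower_cond (F : set pt) (a : R) : Prop :=
  exists C : R, 0 < C /\
    forall r Rr x, 0 < r -> r <= Rr -> Rr < 1 -> F x ->
      ((C * (Rr / r) `^ a)%:E <= Ncov r (cball x Rr `&` F))%E.

(* lower dimension, with the convention sup of the empty set = 0 *)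
Definition dimL (F : set pt) : \bar R :=
  maxe (0:R)%:E (ereal_sup [set a%:E | a in [set a : R | 0 < a /\ lower_cond F a]]).

Definition dimML (E : set pt) : \bar R :=
  ereal_sup [set dimL F | F in [set F : set pt | F !=set0 /\ F `<=` E]].

Definition miniset (K M : set pt) : Prop :=
  exists x lam, K x /\ 1 <= lam /\
    M = [set lam *: (k - x) | k in K] `&` cball 0 1.

Definition nbhd_cl (A : set pt) (eps : R) : set pt :=
  [set y | exists2 a, A a & edist a y <= eps].

Definition hdist (A B : set pt) : \bar R :=
  ereal_inf [set e%:E | e in [set e : R | 0 < e /\ A `<=` nbhd_cl B e /\ B `<=` nbhd_cl A e]].

Definition hconv (En : nat -> set pt) (E : set pt) : Prop :=
  forall eps : R, 0 < eps -> exists N : nat, forall n, (N <= n)%N -> (hdist (En n) E < eps%:E)%E.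

Definition microset (K E : set pt) : Prop :=
  compact E /\ E !=set0 /\
  exists En : nat -> set pt, (forall n, miniset K (En n)) /\ hconv En E.

End Defs.

(* Main.v *)
Require Import Defs.
From HB Require Import structures.
From mathcomp Require Import all_boot all_order all_algebra.
From mathcomp Require Import all_classical all_reals all_analysis.
From mathcomp Require Import zify ring lra.
Import Order.TTheory GRing.Theory Num.Theory.
Import numFieldNormedType.Exports.
Local Open Scope classical_set_scope.
Local Open Scope ring_scope.
Set Implicit Arguments. Unset Strict Implicit. Unset Printing Implicit Defensive.

(* K is the set of points all of whose coordinates have a binary expansion
   supported on a set S of digit positions.  A ball of radius 2^-m meets boundedly
   many dyadic cubes of side 2^-m, each of which contains 2^(d w) cubes of side
   2^-(m + n) meeting K, where w is the number of elements of S in the window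
   [m, m + n).  Hence dim_A K = d theta as soon as w <= (theta + eps) n + O(1)
   uniformly in m, while w >= theta n for windows at 0 with n arbitrarily large.
   If moreover, for every n, each stretch of L(n) scales contains the start of a
   run of n positions missing from S, then every miniset of K, hence (up to a tiny
   Hausdorff error) every microset E, can be covered, near each of its points and
   between two scales of ratio about 2^n, by 5^d small sets.  This bound passes to
   subsets of E, none of which can then have positive lower dimension.  Such an S
   exists for every theta < 1: take the integers whose mixed radix digits avoid the
   top values, with radices and numbers of kept digits chosen so that the densities
   of the successive periodic approximations decrease strictly to theta. *)

(** * Sparse sets of integers with long gaps *)

Definition window (S : nat -> bool) (m n : nat) : nat := (\sum_(m <= i < m + n) S i)%N.

Lemma window0 S m : window S m 0 = 0%N.
Proof. by rewrite /window addn0 big_geq. Qed.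

Lemma windowD S m n p : window S m (n + p) = (window S m n + window S (m + n) p)%N.
Proof. by rewrite /window addnA -big_cat_nat //= leq_addr. Qed.

Lemma windowS S m n : window S m n.+1 = (window S m n + S (m + n))%N.
Proof. by rewrite -addn1 windowD /window [X in bigop _ (index_iota (m + n) X)]addn1 big_nat1. Qed.

Lemma window_le S m n : (window S m n <= n)%N.
Proof.
elim: n => [|n IH]; first by rewrite window0.
by rewrite windowS -addn1 leq_add // leq_b1.
Qed.

Lemma window_leS S m n m' n' : (m' <= m)%N -> (m + n <= m' + n')%N ->
  (window S m n <= window S m' n')%N.
Proof.
move=> h1 h2; have := windowD S m' (m - m') (n + (m' + n' - (m + n))).
rewrite subnKC // (windowD S m n) [X in window S m' X](_ : _ = n'); last by lia.
by move=> ->; lia.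
Qed.

Lemma window_sub (S T : nat -> bool) m n :
  (forall i, (m <= i < m + n)%N -> S i -> T i) -> (window S m n <= window T m n)%N.
Proof.
move=> ST; rewrite /window big_nat [leqRHS]big_nat leq_sum // => i /ST.
by case: (S i) => // ->.
Qed.

(** * Integers with restricted mixed radix digits *)

Section MixedRadix.
Variables N e : nat -> nat.
Hypothesis eN : forall k, (0 < e k < N k)%N.

(** [place k] is the weight of digit [k]; [kept k] counts the integers below it whose digits are all
    allowed. *)
Definition place (k : nat) : nat := (\prod_(i < k) N i)%N.
Definition kept (k : nat) : nat := (\prod_(i < k) e i)%N.
Definition digit_ok (n i : nat) : bool := ((n %/ place i) %% N i < e i)%N.
(** Periodic approximation of [sparse], of period [place k]; the two agree below [place k]. *)
Definition digits_ok (k n : nat) : bool := [forall i : 'I_k, digit_ok n i].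
Definition sparse (n : nat) : bool := `[< forall i, digit_ok n i >].

Lemma placeS k : place k.+1 = (place k * N k)%N.
Proof. by rewrite /place big_ord_recr. Qed.

Lemma keptS k : kept k.+1 = (kept k * e k)%N.
Proof. by rewrite /kept big_ord_recr. Qed.

Lemma place_gt k : (k < place k)%N.
Proof.
elim: k => [|k IH]; first by rewrite /place big_ord0.
rewrite placeS; have := eN k; nia.
Qed.

Lemma place_le k l : (k <= l)%N -> (place k <= place l)%N.
Proof.
move=> /subnKC <-; elim: (l - k)%N => [|n IH]; first by rewrite addn0.
by rewrite addnS placeS (leq_trans IH) // leq_pmulr //; have := eN (k + n); lia.
Qed.

Lemma digits_okS k n : digits_ok k.+1 n = digits_ok k n && digit_ok n k.
Proof.
apply/forallP/andP => [h|[/forallP h1 h2] i].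
  split; last exact: (h ord_max).
  by apply/forallP => i; apply: (h (widen_ord (leqnSn k) i)).
case: (ltnP i k) => [ik|ki]; first exact: (h1 (Ordinal ik)).
by have -> : nat_of_ord i = k by have := ltn_ord i; lia.
Qed.

Lemma sparse_digits_ok k n : sparse n -> digits_ok k n.
Proof. by move=> /asboolP h; apply/forallP => i. Qed.

(** The digits from index [k] on vanish, and 0 is always allowed since [e i] is positive. *)
Lemma digits_ok_sparse k n : (n < place k)%N -> digits_ok k n -> sparse n.
Proof.
move=> nk /forallP h; apply/asboolP => i.
case: (ltnP i k) => [ik|ki]; first exact: (h (Ordinal ik)).
rewrite /digit_ok divn_small ?mod0n; first by case/andP: (eN i).
exact: leq_trans nk (place_le ki).
Qed.

Lemma window_const S p q m l : (forall i, (i < l)%N -> window S (m + i * p) p = q) ->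
  window S m (l * p) = (l * q)%N.
Proof.
elim: l => [|l IH] h; first by rewrite !mul0n window0.
by rewrite mulSnr windowD IH ?h ?mulSnr // => i il; apply: h; lia.
Qed.

(** Induction on [k]: digit [k] is constant on each of the [N k] sub-blocks of length [place k]; the
    first [e k] hold [kept k] elements each, the others none. *)
Lemma digits_ok_block k j : window (digits_ok k) (j * place k) (place k) = kept k.
Proof.
elim: k j => [|k IH] j.
  rewrite /place /kept !big_ord0 windowS window0 /digits_ok.
  by have -> // : [forall i : 'I_0, digit_ok (j * 1 + 0) i] by apply/forallP; case.
have pk : (0 < place k)%N by have := place_gt k; lia.
have [e0 eNk] := andP (eN k).
have dig i n : (i < N k)%N -> (n < place k)%N ->
    digit_ok ((j * N k + i) * place k + n) k = (i < e k)%N.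
  move=> iN np; rewrite /digit_ok divnMDl // divn_small // addn0.
  by rewrite modnMDl modn_small.
rewrite placeS {2}(_ : place k * N k = e k * place k + (N k - e k) * place k)%N; last first.
  by rewrite -mulnDl subnKC 1?mulnC //; lia.
rewrite windowD (window_const (q := kept k)) => [|i ie].
  rewrite (window_const (q := 0%N)) => [|i ie]; first by rewrite keptS muln0 addn0 mulnC.
  apply/eqP; rewrite -leqn0 /window big_nat big1 // => n hn.
  rewrite digits_okS.
  rewrite (_ : n = (j * N k + (e k + i)) * place k +
    (n - ((j * N k + (e k + i)) * place k)))%N; last by nia.
  rewrite dig; [|lia|nia].
  by rewrite ltnNge leq_addr andbF.
rewrite -(IH (j * N k + i)%N) /window !big_nat.
rewrite (_ : j * (place k * N k) + i * place k = (j * N k + i) * place k)%N; last by lia.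
apply: eq_bigr => n hn.
rewrite digits_okS (_ : n = (j * N k + i) * place k + (n - (j * N k + i) * place k))%N; last by lia.
rewrite dig ?ie ?andbT //; lia.
Qed.

Lemma sparse_window0 k : window sparse 0 (place k) = kept k.
Proof.
rewrite -(digits_ok_block k 0) mul0n; apply/eqP; rewrite eqn_leq; apply/andP; split.
  by apply: window_sub => i _; apply: sparse_digits_ok.
by apply: window_sub => i ik; apply: digits_ok_sparse; lia.
Qed.

Lemma sparse_window_le k m n :
  (window sparse m n <= (n %/ place k + 2) * kept k)%N.
Proof.
apply: leq_trans (_ : window (digits_ok k) m n <= _)%N.
  by apply: window_sub => i _; apply: sparse_digits_ok.
have pk : (0 < place k)%N by have := place_gt k; lia.
rewrite -(@window_const (digits_ok k) (place k) _ (m %/ place k * place k)) => [|i _].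
  apply: window_leS; first exact: leq_trunc_div.
  have := divn_eq m (place k); have := divn_eq n (place k).
  have := ltn_pmod m pk; have := ltn_pmod n pk; nia.
by rewrite -mulnDl digits_ok_block.
Qed.

(** The integers whose digit [k] has the forbidden value [(N k).-1] form runs of length [place k],
    which exceeds [k], one run in each period [place k.+1]. *)
Lemma sparse_gap k m : exists p, [/\ (m <= p)%N, (p <= m + 2 * place k.+1)%N &
  window sparse p k = 0%N].
Proof.
have pk := place_gt k; have [e0 eNk] := andP (eN k).
exists ((m %/ place k.+1).+1 * place k.+1 + (N k).-1 * place k)%N.
have P0 : (0 < place k.+1)%N by have := place_gt k.+1; lia.
have := divn_eq m (place k.+1); have := ltn_pmod m P0.
set q := (m %/ _)%N; set r := (m %% _)%N => hr hm; split.
- rewrite hm mulSn; nia.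
- by rewrite hm mulSn !placeS; nia.
rewrite /window big_nat big1 // => n hn; case: (boolP (sparse n)) => // /asboolP /(_ k).
rewrite /digit_ok placeS in hn *.
rewrite (_ : n = (q.+1 * N k + (N k).-1) * place k +
    (n - ((q.+1 * N k + (N k).-1) * place k)))%N; last by nia.
rewrite divnMDl; last by lia.
rewrite [((_ - _) %/ _)%N]divn_small; last by nia.
by rewrite addn0 modnMDl modn_small; lia.
Qed.

End MixedRadix.

(** [e] is taken to be the least integer with [theta * (M * N) < c * e]; a large [N] leaves room for
    [e < N]. *)
Lemma radix_step (R : realType) (theta : R) (c M k : nat) :
  0 <= theta -> theta * M%:R < c%:R ->
  exists N e : nat, [/\ (k < N)%N, (0 < e < N)%N,
    theta * (M * N)%:R < (c * e)%:R & (c * e)%:R <= theta * (M * N)%:R + c%:R].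
Proof.
move=> t0 tc.
have c0 : 0 < c%:R :> R by apply: le_lt_trans tc; rewrite mulr_ge0.
have g0 : 0 < c%:R - theta * M%:R by rewrite subr_gt0.
(* Makes [theta * M * N + c < c * N], hence [e < N]; the summand [k] ensures [k < N]. *)
pose N := (Num.truncn (c%:R / (c%:R - theta * M%:R)) + k).+1.
have hN : c%:R < N%:R * (c%:R - theta * M%:R).
  by rewrite -ltr_pdivrMr // (lt_le_trans (truncnS_gt _)) // ler_nat ltnS leq_addr.
have y0 : 0 <= theta * (M * N)%:R / c%:R by rewrite divr_ge0 // mulr_ge0.
have /andP[h1 h2] := truncn_itv y0.
exists N, (Num.truncn (theta * (M * N)%:R / c%:R)).+1.
set e := Num.truncn _ in h1 h2 *.
have a1 : e%:R * c%:R <= theta * (M * N)%:R by rewrite -ler_pdivlMr.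
have a2 : theta * (M * N)%:R < e.+1%:R * c%:R by rewrite -ltr_pdivrMr.
rewrite [(c * e.+1)%:R]natrM [c%:R * _]mulrC a2; split=> //; first by rewrite ltnS leq_addl.
- rewrite /= -(ltr_nat R) -(ltr_pM2r c0) -natr1 mulrDl mul1r.
  by move: a1 hN; rewrite natrM; lra.
- by rewrite -natr1 mulrDl mul1r lerD2r.
Qed.

(** The density [kept e k.+1 / place N k.+1] stays above [theta] and exceeds it by at most
    [1 / N k], which tends to 0 because [k < N k]. *)
Lemma sparse_set_exists (R : realType) (theta : R) : 0 <= theta -> theta < 1 ->
  exists S : nat -> bool, [/\
    forall k, exists L, forall m, exists p,
      [/\ (m <= p)%N, (p <= m + L)%N & window S p k = 0%N],
    forall eps, 0 < eps -> exists B : nat, forall m n,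
      (window S m n)%:R <= (theta + eps) * n%:R + B%:R &
    forall n0, exists2 n, (n0 <= n)%N & theta * n%:R <= (window S 0 n)%:R].
Proof.
move=> t0 t1.
have step : forall kcM : nat * (nat * nat), exists Ne : nat * nat,
    theta * kcM.2.2%:R < kcM.2.1%:R ->
    [/\ (kcM.1 < Ne.1)%N, (0 < Ne.2 < Ne.1)%N,
    theta * (kcM.2.2 * Ne.1)%:R < (kcM.2.1 * Ne.2)%:R &
    (kcM.2.1 * Ne.2)%:R <= theta * (kcM.2.2 * Ne.1)%:R + kcM.2.1%:R].
  move=> [k [c M]] /=; case: (ltrP (theta * M%:R) c%:R) => h; last by exists (0%N, 0%N).
  by have [N [e [h1 h2 h3 h4]]] := radix_step k t0 h; exists (N, e).
have [f hf] := choice step.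
(* The pair is [(kept e k, place N k)], built together since each radix depends on both. *)
pose cM := fix cM k := if k is k.+1 then
  ((cM k).1 * (f (k, cM k)).2, (cM k).2 * (f (k, cM k)).1)%N else (1%N, 1%N).
pose N k := (f (k, cM k)).1; pose e k := (f (k, cM k)).2.
have keptE k : kept e k = (cM k).1.
  by elim: k => [|k IH]; rewrite ?keptS ?IH // /kept big_ord0.
have placeE k : place N k = (cM k).2.
  by elim: k => [|k IH]; rewrite ?placeS ?IH // /place big_ord0.
have above k : theta * (cM k).2%:R < (cM k).1%:R.
  elim: k => [|k IH] /=; first by rewrite mulr1.
  by case: (hf (k, cM k) IH).
have eN k : (0 < e k < N k)%N by case: (hf (k, cM k) (above k)).
have kN k : (k < N k)%N by case: (hf (k, cM k) (above k)).
have close k : (kept e k.+1)%:R <= theta * (place N k.+1)%:R + (kept e k)%:R.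
  by rewrite !keptE !placeE; case: (hf (k, cM k) (above k)).
have kp k : (kept e k <= place N k)%N.
  elim: k => [|k IH]; first by rewrite /kept /place !big_ord0.
  by rewrite keptS placeS leq_mul //; have := eN k; lia.
exists (sparse N e); split.
- by move=> k; exists (2 * place N k.+1)%N => m; apply: sparse_gap.
- move=> eps eps0; pose k := Num.truncn eps^-1.
  exists (2 * kept e k.+1)%N => m n.
  have pk : 0 < (place N k.+1)%:R :> R by rewrite ltr0n; have := place_gt eN k.+1; lia.
  have dens : (kept e k.+1)%:R <= (theta + eps) * (place N k.+1)%:R.
    rewrite (le_trans (close k)) // mulrDl lerD2l placeS natrM.
    have h1 : eps^-1 <= (N k)%:R.
      by apply: le_trans (ltW (truncnS_gt _)) _; rewrite ler_nat; apply: kN.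
    have h2 : 1 <= eps * (N k)%:R by rewrite mulrC -ler_pdivrMr // mul1r.
    have h3 : (kept e k)%:R <= (place N k)%:R :> R by rewrite ler_nat.
    by rewrite mulrCA; apply: (le_trans h3); rewrite ler_peMr.
  apply: le_trans (_ : ((n %/ place N k.+1 + 2) * kept e k.+1)%:R <= _).
    by rewrite ler_nat sparse_window_le.
  rewrite mulnDl natrD lerD2r natrM.
  apply: le_trans (ler_wpM2l _ dens) _ => //.
  rewrite mulrCA; apply: ler_wpM2l; first by rewrite addr_ge0 // ltW.
  by rewrite -natrM ler_nat leq_trunc_div.
- move=> n0; exists (place N n0); first exact: (ltnW (place_gt eN n0)).
  by rewrite sparse_window0 // keptE placeE ltW.
Qed.

(** * The Cantor set of binary expansions with prescribed digit positions *)

Section CantorSet.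
Variable S : nat -> bool.

(* [k] encodes the first [n] binary digits, the last digit being [odd k]. *)
Fixpoint prefix_ok (n k : nat) : bool :=
  if n is n'.+1 then prefix_ok n' k./2 && (odd k ==> S n') else k == 0%N.

(** Lists the prefixes of length [m + n] that continue the prefix [j] of length [m] by digits
    allowed by [S]. *)
Fixpoint extend (m n j : nat) : seq nat :=
  if n is n'.+1 then
    map double (extend m n' j) ++
    (if S (m + n') then map (fun k => k.*2.+1) (extend m n' j) else [::])
  else [:: j].

Lemma prefix_ok0 n : prefix_ok n 0.
Proof. by elim: n => //= n ->. Qed.

Lemma prefix_ok_div m n k : prefix_ok (m + n) k -> prefix_ok m (k %/ 2 ^ n).
Proof.
elim: n k => [|n IH] k; first by rewrite addn0 divn1.
by rewrite addnS /= => /andP[/IH h _]; rewrite expnS divnMA divn2.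
Qed.

Lemma prefix_ok_mul m n k : prefix_ok m k -> prefix_ok (m + n) (k * 2 ^ n).
Proof.
move=> h; elim: n => [|n IH]; first by rewrite addn0 muln1.
by rewrite addnS /= expnSr mulnA muln2 doubleK odd_double IH.
Qed.

Lemma prefix_ok_lt n k : prefix_ok n k -> (k < 2 ^ n)%N.
Proof.
elim: n k => [|n IH] k /=; first by move=> /eqP ->.
by move=> /andP[/IH h _]; rewrite expnS; lia.
Qed.

Lemma size_extend m n j : size (extend m n j) = (2 ^ window S m n)%N.
Proof.
elim: n => [|n IH] /=; first by rewrite window0.
rewrite size_cat size_map windowS; case: (S _); rewrite /= ?size_map IH ?addn1 ?addn0 //.
by rewrite expnS; lia.
Qed.

Lemma extend_uniq m n j : uniq (extend m n j).
Proof.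
elim: n => [|n IH] //=; rewrite cat_uniq map_inj_uniq ?IH /=; last by apply: double_inj.
case: (S _) => //=; apply/andP; split.
  by apply/hasPn => _ /mapP[a _ ->]; apply/negP => /mapP[b _]; lia.
by rewrite map_inj_uniq // => a b; lia.
Qed.

Lemma mem_extend m n k : prefix_ok (m + n) k -> k \in extend m n (k %/ 2 ^ n).
Proof.
elim: n k => [|n IH] k; first by rewrite divn1 inE eqxx.
rewrite addnS /= => /andP[/IH h o].
rewrite expnS divnMA divn2 mem_cat; move: o; case: (boolP (odd k)) => /= ok.
  move=> ->; apply/orP; right; apply/mapP; exists k./2 => //; lia.
by move=> _; apply/orP; left; apply/mapP; exists k./2 => //; lia.
Qed.

Lemma prefix_ok_extend m n j k :
  prefix_ok m j -> k \in extend m n j -> prefix_ok (m + n) k.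
Proof.
move=> hj; elim: n k => [|n IH] k; first by rewrite inE addn0 => /eqP ->.
rewrite addnS /= mem_cat => /orP[/mapP[a /IH ha ->]|].
  by rewrite doubleK ha odd_double.
case: (S _) => // /mapP[a /IH ha ->].
by rewrite implybT andbT -[_.+1]/(true + a.*2)%N half_bit_double.
Qed.

Lemma extend_lt m n j k : k \in extend m n j -> (k < j.+1 * 2 ^ n)%N.
Proof.
elim: n k => [|n IH] k /=; first by rewrite inE muln1 => /eqP ->.
rewrite mem_cat expnS => /orP[/mapP[a /IH ha ->]|]; first by lia.
by case: ifP => // _ /mapP[a /IH ha ->]; lia.
Qed.

Variable R : realType.
Implicit Types x y z : R.

Definition in_cell (n k : nat) (x : R) : Prop := k%:R <= x * 2 ^+ n <= k.+1%:R.

(** Cells are closed and those of different levels are chosen independently, so the set is an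
    intersection of finite unions of closed intervals. *)
Definition cantor : set R := [set x | forall n, exists2 k, prefix_ok n k & in_cell n k x].

Lemma in_cell_div m n k x : in_cell (m + n) k x -> in_cell m (k %/ 2 ^ n) x.
Proof.
have p0 : 0 < 2 ^+ n :> R by rewrite exprn_gt0.
rewrite /in_cell exprD mulrA => /andP[h1 h2]; apply/andP; split.
  rewrite -(ler_pM2r p0); apply: le_trans h1.
  by rewrite -natrX -natrM ler_nat leq_trunc_div.
rewrite -(ler_pM2r p0); apply: (le_trans h2).
by rewrite -natrX -natrM ler_nat ltn_ceil // expn_gt0.
Qed.

Lemma cantor_dyadic n k : prefix_ok n k -> cantor (k%:R / 2 ^+ n).
Proof.
have p j : 2 ^+ j != 0 :> R by rewrite expf_neq0.
move=> hk j; case: (leqP j n) => [jn|nj].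
  exists (k %/ 2 ^ (n - j))%N; first by apply: prefix_ok_div; rewrite subnKC.
  apply: in_cell_div; rewrite subnKC // /in_cell divfK; last exact: p.
  by rewrite lexx ler_nat leqnSn.
exists (k * 2 ^ (j - n))%N; first by rewrite -{1}(subnKC (ltnW nj)) prefix_ok_mul.
have -> : in_cell j (k * 2 ^ (j - n)) (k%:R / 2 ^+ n) =
    in_cell (n + (j - n)) (k * 2 ^ (j - n)) (k%:R / 2 ^+ n) by rewrite subnKC // ltnW.
by rewrite /in_cell exprD mulrA divfK // -natrX -natrM lexx ler_nat leqnSn.
Qed.

Lemma cantor0 : cantor 0.
Proof. by rewrite -(mul0r (2 ^+ 0)^-1); apply: (@cantor_dyadic 0 0). Qed.

Lemma closed_cantor : closed cantor.
Proof.
pose cell n k : set R := [set x | in_cell n k x].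
have -> : cantor = \bigcap_(n in setT) \bigcup_(k in [set k | prefix_ok n k]) cell n k.
  apply/seteqP; split=> x h n; last by have [k] := h n I; exists k.
  by move=> _; have [k] := h n; exists k.
apply: closed_bigI => n _; apply: closed_bigcup.
  apply: (@sub_finite_set _ _ `I_(2 ^ n)) => //= k; exact: prefix_ok_lt.
move=> k _.
have -> : cell n k = `[(k%:R / 2 ^+ n), (k.+1%:R / 2 ^+ n)]%classic.
  apply/seteqP; split=> x; rewrite /cell /in_cell /= in_itv /=;
    by rewrite ler_pdivrMr ?exprn_gt0 // ler_pdivlMr ?exprn_gt0.
exact: interval_closed.
Qed.

Lemma compact_cantor : compact cantor.
Proof.
apply: (subclosed_compact closed_cantor (segment_compact (a := 0) (b := 1))).
move=> x /(_ 0%N)[k /= /eqP -> ]; rewrite /in_cell expr0 mulr1 /= in_itv /=.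
by [].
Qed.

(* The level [m] cell of [y] is at most two cells away from that of [x]. *)
Lemma cantor_near_cells m n x : cantor x -> exists2 s : seq nat,
  size s = (5 * 2 ^ window S m n)%N &
  forall y, cantor y -> `|y - x| <= 2 ^- m -> exists2 k, k \in s & in_cell (m + n) k y.
Proof.
(* The five cells from [jx - 2] to [jx + 2]; when truncation at 0 shifts the list up, it still
   contains all cells up to [jx + 2]. *)
move=> /(_ m)[jx _ hjx]; exists (flatten [seq extend m n j | j <- iota (jx - 2) 5]).
  rewrite size_flatten /shape -map_comp.
  by rewrite (eq_map (g := fun=> (2 ^ window S m n)%N)) /= => [|j]; [lia|exact: size_extend].
move=> y /(_ (m + n)%N)[k kok hk] yx; exists k => //.
apply/flatten_mapP; exists (k %/ 2 ^ n)%N; last exact: mem_extend.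
have := in_cell_div hk; set j := (k %/ 2 ^ n)%N.
have p0 : 0 < 2 ^+ m :> R by rewrite exprn_gt0.
move: yx; rewrite -(ler_pM2r p0) -{1}(ger0_norm (ltW p0)) -normrM mulVf ?lt0r_neq0 //.
rewrite mulrBl ler_norml => /andP[h1 h2] /andP[h3 h4]; move: hjx => /andP[h5 h6].
have jx1 : (j <= jx + 2)%N.
  rewrite -(ler_nat R) natrD; move: h6; rewrite -natr1; lra.
have jx2 : (jx <= j + 2)%N.
  rewrite -(ler_nat R) natrD; move: h4; rewrite -natr1; lra.
by rewrite mem_iota; lia.
Qed.

(** The code of a nearby point is the position, in the list of the preceding lemma, of a cell
    containing it; equal codes mean a common cell of side [2 ^- (m + n)]. *)
Lemma cantor_near_code m n x : cantor x -> exists f : R -> 'I_(5 * 2 ^ window S m n),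
  forall y z, cantor y -> cantor z -> `|y - x| <= 2 ^- m -> `|z - x| <= 2 ^- m ->
  f y = f z -> `|y - z| <= 2 ^- (m + n).
Proof.
move=> /(cantor_near_cells m n)[s ss hs].
have N0 : (0 < 5 * 2 ^ window S m n)%N by rewrite muln_gt0 expn_gt0.
have ex y : exists t : 'I_(5 * 2 ^ window S m n),
    cantor y -> `|y - x| <= 2 ^- m -> in_cell (m + n) (nth 0%N s t) y.
  have [[cy yx]|h] := pselect (cantor y /\ `|y - x| <= 2 ^- m); last first.
    by exists (Ordinal N0) => cy yx; case: h.
  have [k ks ck] := hs y cy yx.
  have ix : (index k s < 5 * 2 ^ window S m n)%N by rewrite -ss index_mem.
  by exists (Ordinal ix) => _ _ /=; rewrite nth_index.
have [f hf] := choice ex; exists f => y z cy cz yx zx fyz.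
have := hf z cz zx; have := hf y cy yx; rewrite fyz.
have p0 : 0 < 2 ^+ (m + n) :> R by rewrite exprn_gt0.
move=> /andP[h1 h2] /andP[h3 h4].
rewrite -(ler_pM2r p0) -{1}(ger0_norm (ltW p0)) -normrM mulVf ?lt0r_neq0 //.
rewrite mulrBl ler_norml; move: h2 h4; rewrite -natr1 => h2 h4; lra.
Qed.

Definition cantor_prod (d : nat) : set 'rV[R]_d := [set v | forall i, cantor (v ord0 i)].

Lemma compact_cantor_prod d : compact (@cantor_prod d).
Proof. by apply: (rV_compact (A := fun=> cantor)) => i; apply: compact_cantor. Qed.

Lemma cantor_prod_near_code d m n (x : 'rV[R]_d) : cantor_prod x ->
  exists f : 'rV[R]_d -> {ffun 'I_d -> 'I_(5 * 2 ^ window S m n)},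
  forall y z : 'rV[R]_d, cantor_prod y -> cantor_prod z ->
  (forall i, `|y ord0 i - x ord0 i| <= 2 ^- m) ->
  (forall i, `|z ord0 i - x ord0 i| <= 2 ^- m) ->
  f y = f z -> forall i, `|y ord0 i - z ord0 i| <= 2 ^- (m + n).
Proof.
move=> cx; have [g hg] := choice (fun i => cantor_near_code m n (cx i)).
exists (fun v => [ffun i => g i (v ord0 i)]) => y z cy cz yx zx /ffunP fyz i.
by apply: (hg i) => //; have := fyz i; rewrite !ffunE.
Qed.

End CantorSet.

(** * Covering numbers and Assouad dimension *)

(* [edist] alone would denote the extended distance of mathcomp-analysis. *)
Local Notation edist := Defs.edist.

Section Covering.
Variables (R : realType) (d : nat).
Implicit Types (x y z : 'rV[R]_d) (F : set 'rV[R]_d) (r : R).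

Lemma coord_le_edist x y i : `|x ord0 i - y ord0 i| <= edist x y.
Proof.
rewrite -sqrtr_sqr ler_wsqrtr // (bigD1 i) //= lerDl.
by apply: sumr_ge0 => j _; apply: sqr_ge0.
Qed.

(** The factor [2 ^+ d], cruder than the square root of [d], keeps all scales powers of two. *)
Lemma edist_le x y b : 0 <= b -> (forall i, `|x ord0 i - y ord0 i| <= b) ->
  edist x y <= 2 ^+ d * b.
Proof.
move=> b0 h; have B0 : 0 <= 2 ^+ d * b by rewrite mulr_ge0 // exprn_ge0.
rewrite -(ger0_norm B0) -sqrtr_sqr ler_wsqrtr //.
apply: le_trans (_ : \sum_(i < d) b ^+ 2 <= _).
  by apply: ler_sum => i _; rewrite -real_normK ?num_real // lerXn2r ?nnegrE.
rewrite sumr_const card_ord -[_ *+ _]mulr_natl exprMn ler_wpM2r ?sqr_ge0 //.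
have h1 : d%:R <= 2 ^+ d :> R by rewrite -natrX ler_nat ltnW // ltn_expl.
have h2 : 1 <= 2 ^+ d :> R by rewrite exprn_ege1 // ler1n.
by rewrite expr2 (le_trans h1) // ler_peMl // exprn_ge0.
Qed.

(** Each non-empty fibre of [f] on [F] supplies one centre covering it; the default 0 of an empty
    fibre is retained only if it lies in [F]. *)
Lemma Ncov_le (T : finType) (f : 'rV[R]_d -> T) F r :
  (forall y z, F y -> F z -> f y = f z -> edist y z <= r) ->
  (Ncov r F <= (#|T|%:R)%:E)%E.
Proof.
move=> h.
have ex t : exists y, forall z, F z -> f z = t -> F y /\ f y = t.
  have [[y [Fy fy]]|n] := pselect (exists y, F y /\ f y = t); first by exists y.
  by exists 0 => z Fz fz; case: n; exists z.
have [p hp] := choice ex.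
pose s := [seq p t | t <- enum T & `[< F (p t) >]].
apply: (@le_trans _ _ ((size s)%:R)%:E); last first.
  by rewrite lee_fin ler_nat size_map size_filter (leq_trans (count_size _ _)) // cardE.
apply: ereal_inf_lbound; exists s => //; split.
  by move=> c /mapP[t]; rewrite mem_filter => /andP[/asboolP Fp _] ->.
move=> y Fy; have [Fp fp] := hp (f y) y Fy erefl.
exists (p (f y)); last exact: h.
by apply/mapP; exists (f y) => //; rewrite mem_filter mem_enum andbT; apply/asboolP.
Qed.

(** Each ball contains at most one [g t], so sending [t] to a centre that covers [g t] is
    injective. *)
Lemma Ncov_ge (T : finType) (g : T -> 'rV[R]_d) F r :
  (forall t, F (g t)) ->
  (forall c t u, edist c (g t) <= r -> edist c (g u) <= r -> t = u) ->
  ((#|T|%:R)%:E <= Ncov r F)%E.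
Proof.
move=> Fg sep; apply: le_ereal_inf_tmp => _ [s [_ cov] <-].
have ex t : exists c, c \in s /\ edist c (g t) <= r by have [c] := cov _ (Fg t); exists c.
have [h hh] := choice ex.
rewrite lee_fin ler_nat cardE -(size_map h) uniq_leq_size //.
  rewrite map_inj_uniq ?enum_uniq // => t u htu.
  have [_ ht] := hh t; have [_ hu] := hh u.
  by apply: (sep (h t)) => //; rewrite htu.
by move=> _ /mapP[t _ ->]; case: (hh t).
Qed.

End Covering.

Section PowersOfTwo.
Variable R : realType.

Lemma pow2_unbounded (b M : R) : 0 < b ->
  exists n0 : nat, forall n : nat, (n0 <= n)%N -> M < 2 `^ (b * n%:R).
Proof.
move=> b0; have l0 : 0 < b * ln 2 by rewrite mulr_gt0 // ln_gt0 // ltr1n.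
exists (Num.truncn (M / (b * ln 2))).+1 => n hn.
rewrite /powR pnatr_eq0 /= (lt_le_trans _ (expR_ge1Dx _)) //.
have : M < n%:R * (b * ln 2).
  rewrite -ltr_pdivrMr // (lt_le_trans (truncnS_gt _)) // ler_nat //.
rewrite mulrA [n%:R * b]mulrC; lra.
Qed.

Lemma pow2_bracket (x : R) : 1 <= x -> exists s : nat, 2 ^+ s <= x < 2 ^+ s.+1.
Proof.
move=> x1; have ex : exists n : nat, x < 2 ^+ n.
  exists (Num.truncn x).+1; rewrite (lt_le_trans (truncnS_gt _)) // -natrX ler_nat ltnW //.
  exact: ltn_expl.
case: (ex_minnP ex) => -[|n] h1 h2; first by move: h1; rewrite expr0; lra.
by exists n; rewrite h1 andbT leNgt; apply/negP => /h2; rewrite ltnn.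
Qed.

(** Distinct dyadic points of level [n] are at least [2 ^- n] apart, twice the sum of the two
    radii. *)
Lemma dyadic_sep (c : R) (n k l : nat) : `|c - k%:R / 2 ^+ n| <= 2 ^- n.+2 ->
  `|c - l%:R / 2 ^+ n| <= 2 ^- n.+2 -> k = l.
Proof.
wlog kl : k l / (k <= l)%N => [h|] h1 h2.
  by case/orP: (leq_total k l) => kl; [apply: h|apply/esym/h].
have pn : 0 < 2 ^+ n.+2 :> R by rewrite exprn_gt0.
have : `|k%:R / 2 ^+ n - l%:R / 2 ^+ n| <= 2 ^- n.+2 + 2 ^- n.+2 :> R.
  by apply: le_trans (ler_distD c _ _) _; rewrite distrC lerD.
rewrite -(ler_pM2r pn) -{1}(ger0_norm (ltW pn)) -normrM.
have -> : (2 ^- n.+2 + 2 ^- n.+2) * 2 ^+ n.+2 = 2%:R :> R.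
  by rewrite mulrDl mulVf ?lt0r_neq0.
have -> : (k%:R / 2 ^+ n - l%:R / 2 ^+ n) * 2 ^+ n.+2 = - ((l - k) * 4)%:R :> R.
  rewrite natrM natrB // !exprS; field.
  by rewrite expf_neq0.
rewrite normrN normr_nat ler_nat; lia.
Qed.

End PowersOfTwo.

(** * Assouad dimension of the product set *)

Section AssouadDimension.
Variables (R : realType) (d : nat) (S : nat -> bool) (theta : R).
Hypothesis d0 : (0 < d)%N.
Hypothesis theta0 : 0 <= theta.
Let K : set 'rV[R]_d := cantor_prod S (d := d).

Lemma assouad_cond_cantor_prod (a : R) :
  (forall eps, 0 < eps -> exists B : nat, forall m n,
      (window S m n)%:R <= (theta + eps) * n%:R + B%:R) ->
  theta * d%:R < a -> assouad_cond K a.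
Proof.
move=> upper ta; have dR : 0 < d%:R :> R by rewrite ltr0n.
have a0 : 0 <= a by apply: ltW; apply: le_lt_trans ta; rewrite mulr_ge0.
have [|B hB] := upper (a / d%:R - theta); first by rewrite subr_gt0 ltr_pdivlMr.
(* [5 ^+ d] counts neighbouring cells, [2 ^+ (B * d)] absorbs the additive error, and
   [2 ^+ n <= 2 ^+ d.+2 * (Rr / r)] gives the last factor. *)
exists (5 ^+ d * 2 ^+ (B * d) * (2 ^+ d.+2) `^ a); split.
  by rewrite !mulr_gt0 ?exprn_gt0 ?powR_gt0 ?exprn_gt0.
move=> r Rr x r0 rR R1 Kx.
have R0 : 0 < Rr by apply: lt_le_trans rR.
have [|m /andP[m1 m2]] := @pow2_bracket R Rr^-1; first by rewrite invf_ge1 // ltW.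
have [|u /andP[u1 u2]] := @pow2_bracket R r^-1; first by rewrite invf_ge1 // (le_trans rR) // ltW.
have mu : (m <= u)%N.
  rewrite -ltnS -(ltr_eXn2l _ _ (x := 2 : R)) ?ltr1n //.
  by apply: (le_lt_trans m1); apply: le_lt_trans u2; rewrite lef_pV2.
(* Cells of level [m + n] have side [2 ^- (u.+1 + d)], so their diameter is at most
   [2 ^- u.+1 <= r]. *)
pose n := (u.+1 + d - m)%N.
have mn : (m + n = u.+1 + d)%N by rewrite subnKC // (leq_trans (leqW mu)) // leq_addr.
have [f hf] := cantor_prod_near_code m n Kx.
have Rm : Rr <= 2 ^- m by rewrite -[Rr]invrK lef_pV2 ?posrE ?invr_gt0 ?exprn_gt0.
apply: le_trans (Ncov_le (f := f) _) _.
  move=> y z [By Ky] [Bz Kz] fyz.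
  apply: le_trans (edist_le (b := 2 ^- (m + n)) _ _) _; first by rewrite invr_ge0 exprn_ge0.
    move=> i; apply: hf => // j; rewrite distrC (le_trans (coord_le_edist _ _ _)) //.
      exact: le_trans Rm.
    exact: le_trans Rm.
  rewrite mn exprD invfM mulrCA mulfV ?expf_neq0 // mulr1.
  by rewrite -[r]invrK lef_pV2 ?posrE ?invr_gt0 ?exprn_gt0 // ltW.
rewrite lee_fin card_ffun !card_ord natrX natrM exprMn -!mulrA ler_wpM2l ?exprn_ge0 //.
set w := window S m n.
have hw : w%:R * d%:R <= a * n%:R + (B * d)%:R.
  have := hB m n; rewrite subrKC -/w natrM => h.
  rewrite (le_trans (ler_wpM2r (ltW dR) h)) // mulrDl lerD2r mulrAC divfK //.
  exact: lt0r_neq0.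
have -> : (2 ^ w)%:R ^+ d = 2 `^ (w%:R * d%:R) :> R.
  by rewrite natrX -exprM -natrM powR_mulrn.
apply: le_trans (ler_powR _ hw) _; first by rewrite ler1n.
rewrite powRD ?pnatr_eq0 ?implybT // powR_mulrn // mulrC ler_wpM2l ?exprn_ge0 //.
rewrite -powRM ?exprn_ge0 ?divr_ge0 ?(ltW R0) ?(ltW r0) //.
rewrite mulrC powRrM powR_mulrn //.
apply: ge0_ler_powR => //; rewrite ?nnegrE ?exprn_ge0 //.
  by rewrite mulr_ge0 ?exprn_ge0 ?divr_ge0 ?(ltW R0) ?(ltW r0).
have pm : 0 < 2 ^+ m :> R by rewrite exprn_gt0.
rewrite -(ler_pM2l pm) -exprD mn exprD !exprS.
have h1 : 1 <= Rr * (2 * 2 ^+ m).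
  by rewrite mulrC -ler_pdivrMr // mul1r -exprS ltW.
have h2 : 2 ^+ u <= r^-1 * (Rr * (2 * 2 ^+ m)).
  by rewrite (le_trans u1) // ler_peMr // invr_ge0 ltW.
rewrite [leRHS](_ : _ = 2 * 2 ^+ d * (r^-1 * (Rr * (2 * 2 ^+ m)))); last by ring.
by rewrite mulrAC ler_wpM2l // mulr_ge0 // exprn_ge0.
Qed.

(** For arbitrarily large [n], the dyadic points of level [n] near the origin number at least a
    constant times 2 to the power [theta * d * n] and are separated at scale [2 ^- n], which is too
    many if [a < theta * d]. *)
Lemma assouad_cond_cantor_prod_ge (a : R) :
  (forall n0, exists2 n, (n0 <= n)%N & theta * n%:R <= (window S 0 n)%:R) ->
  0 < a -> assouad_cond K a -> theta * d%:R <= a.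
Proof.
move=> lower a0 [C [C0 hC]]; rewrite leNgt; apply/negP => ta.
(* [q] leading zeros make each coordinate at most [2 ^- q], so the point lies within
   [2 ^+ d * 2 ^- q = 2^-1] of the origin. *)
pose q := d.+1.
have b0 : 0 < theta * d%:R - a by rewrite subr_gt0.
(* The power of exponent [a] comes from the ratio [2 ^+ n.+1] of the radii, and [2 ^+ (q * d)] from
   the digits lost to the leading zeros. *)
have [n0 hn0] := pow2_unbounded (C * 2 `^ a * 2 ^+ (q * d)) b0.
have [n nq hw] := lower (n0 + q)%N.
have {hn0} := hn0 n; rewrite (leq_trans (leq_addr _ _) nq) => /(_ isT).
apply/negP; rewrite -leNgt.
pose n' := (n - q)%N; have qn : (q + n' = n)%N by rewrite /n'; lia.
pose w := window S q n'.
pose g (t : {ffun 'I_d -> 'I_(2 ^ w)}) : 'rV[R]_d :=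
  \row_i ((nth 0%N (extend S q n' 0) (t i))%:R / 2 ^+ n).
have memg (t : {ffun 'I_d -> 'I_(2 ^ w)}) i :
    nth 0%N (extend S q n' 0) (t i) \in extend S q n' 0.
  by rewrite mem_nth // size_extend.
have pn : 0 < 2 ^+ n :> R by rewrite exprn_gt0.
have Kg t : K (g t).
  move=> i; rewrite mxE; apply: cantor_dyadic.
  by rewrite -qn; apply: prefix_ok_extend (memg t i); apply: prefix_ok0.
have Bg t : cball 0 2^-1 (g t).
  apply: le_trans (edist_le (b := 2 ^- q) _ _) _; first by rewrite invr_ge0 exprn_ge0.
    move=> i; rewrite !mxE sub0r normrN ger0_norm ?divr_ge0 ?exprn_ge0 //.
    rewrite ler_pdivrMr // -qn exprD mulKf ?expf_neq0 // -natrX ler_nat ltnW //.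
    by have := extend_lt (memg t i); rewrite mul1n.
  by rewrite /q exprSr invfM mulVKf ?expf_neq0.
pose r : R := 2 ^- n.+2.
have r0 : 0 < r by rewrite invr_gt0 exprn_gt0.
have sep c t u : edist c (g t) <= r -> edist c (g u) <= r -> t = u.
  move=> ct cu; apply/ffunP => i; apply: val_inj => /=.
  apply/eqP; rewrite -(nth_uniq 0%N _ _ (extend_uniq S q n' 0)) ?size_extend //; apply/eqP.
  have := le_trans (coord_le_edist _ _ i) ct; have := le_trans (coord_le_edist _ _ i) cu.
  by rewrite !mxE => h1 h2; apply: dyadic_sep h2 h1.
have r2 : r <= 2^-1 by rewrite lef_pV2 ?posrE ?exprn_gt0 // exprS ler_peMr // exprn_ege1 // ler1n.
have h2 : 2^-1 < 1 :> R by rewrite invf_lt1 // ltr1n.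
have K0 : K 0 by move=> i; rewrite mxE; apply: cantor0.
move: (hC r 2^-1 0 r0 r2 h2 K0) => /(le_trans (Ncov_ge (g := g) (fun t => conj (Bg t) (Kg t)) sep)).
rewrite lee_fin card_ffun !card_ord /r invrK exprS mulKf //.
have -> : ((2 ^ w) ^ d)%:R = 2 `^ (w%:R * d%:R) :> R.
  by rewrite -expnM natrX -natrM powR_mulrn.
have -> : (2 ^+ n.+1) `^ a = 2 `^ (a * n%:R) * 2 `^ a :> R.
  rewrite -powRD ?pnatr_eq0 ?implybT // [a * _ + a](_ : _ = n.+1%:R * a).
    by rewrite powRrM powR_mulrn.
  by rewrite -natr1 mulrDl mul1r mulrC.
have hw2 : (window S 0 n <= q + w)%N.
  by rewrite -qn windowD leq_add2r window_le.
have hw3 : theta * n%:R * d%:R <= w%:R * d%:R + (q * d)%:R.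
  rewrite natrM -mulrDl ler_wpM2r // (le_trans hw) // -natrD ler_nat addnC.
  exact: hw2.
have {}hw3 : 2 `^ (theta * d%:R * n%:R) <= 2 `^ (w%:R * d%:R) * 2 ^+ (q * d) :> R.
  rewrite -(powR_mulrn (q * d)) // -powRD ?pnatr_eq0 ?implybT //.
  by apply: ler_powR; rewrite ?ler1n // mulrAC.
move=> h; have p1 : 0 < 2 `^ (a * n%:R) :> R by rewrite powR_gt0.
rewrite -(ler_pM2r p1) -powRD ?pnatr_eq0 ?implybT // -mulrDl subrK.
apply: (le_trans hw3); apply: le_trans (ler_wpM2r _ h) _; first by rewrite exprn_ge0.
by rewrite [leLHS](_ : _ = C * 2 `^ a * 2 ^+ (q * d) * 2 `^ (a * n%:R)) //; ring.
Qed.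

Lemma dimA_cantor_prod :
  (forall eps, 0 < eps -> exists B : nat, forall m n,
      (window S m n)%:R <= (theta + eps) * n%:R + B%:R) ->
  (forall n0, exists2 n, (n0 <= n)%N & theta * n%:R <= (window S 0 n)%:R) ->
  dimA K = (theta * d%:R)%:E.
Proof.
move=> upper lower; apply/eqP; rewrite eq_le; apply/andP; split; last first.
  by apply: le_ereal_inf_tmp => _ [a [a0 ha] <-]; rewrite lee_fin assouad_cond_cantor_prod_ge.
apply/lee_addgt0Pr => eps eps0; apply: ereal_inf_lbound.
exists (theta * d%:R + eps) => //; split; first by rewrite ltr_wpDl // mulr_ge0.
by apply: assouad_cond_cantor_prod => //; rewrite ltrDl.
Qed.

End AssouadDimension.

(** * Microsets *)

Section Microsets.
Variables (R : realType) (d : nat) (S : nat -> bool).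
Hypothesis gaps : forall k, exists L, forall m, exists p,
  [/\ (m <= p)%N, (p <= m + L)%N & window S p k = 0%N].
Let K : set 'rV[R]_d := cantor_prod S (d := d).

Lemma coord_triangle (lam e u v a b c : R) : 0 < lam ->
  `|lam * (u - c) - a| <= e -> `|lam * (v - c) - b| <= e ->
  `|lam * (u - v) - (a - b)| <= 2 * e.
Proof.
move=> l0 h1 h2.
have -> : lam * (u - v) - (a - b) = (lam * (u - c) - a) - (lam * (v - c) - b) by ring.
by apply: le_trans (ler_normB _ _) _; rewrite mulr_natl mulr2n lerD.
Qed.

(** Pulling points of [F] back to [K] turns a ball into a neighbourhood whose next [n] digit
    positions miss [S], so [5 ^+ d] small balls cover it, too few for a positive exponent [a] once
    [n0] is large. *)
Lemma microset_not_lower_cond (E F : set 'rV[R]_d) (a : R) :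
  microset K E -> F !=set0 -> F `<=` E -> 0 < a -> ~ lower_cond F a.
Proof.
move=> [_ [_ [En [mini conv]]]] [x Fx] FE a0 [C [C0 hC]].
have [n0 /(_ n0 (leqnn _)) hn0] := pow2_unbounded (5 ^+ d / C) a0.
(* The extra [d.+2] levels pay for the Euclidean factor [2 ^+ d], the Hausdorff error and the halved
   radius [Rr]. *)
pose n := (n0 + d.+2)%N.
have [L hL] := gaps n.
(* The tolerance is fixed before [lam] is known: [2 ^+ s <= lam] and [m <= s + L] will give
   [2 ^- (L + n).+1 <= lam * 2 ^- (m + n).+1]. *)
have [|j hj] := conv (2 ^- (L + n).+1); first by rewrite invr_gt0 exprn_gt0.
have {hj} [_ [e [e0 [_ Ee]] <-]] := ereal_inf_lt (hj j (leqnn _)); rewrite lte_fin => ee.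
have [x0 [lam [Kx0 [lam1 Ej]]]] := mini j.
have [s /andP[s1 s2]] := pow2_bracket lam1.
(* Since [lam < 2 ^+ s.+1], the bound [s <= m] will give [Rr < 1]. *)
have [m [sm mL gap]] := hL s.
have lam0 : 0 < lam by apply: lt_le_trans lam1.
(* Each point of [E] is approximated by the blow-up of a point of [K], later called [h z]; 0 is the
   default off [E]. *)
have ex z : exists k, E z -> K k /\ forall i, `|lam * (k ord0 i - x0 ord0 i) - z ord0 i| <= e.
  have [Ez|nE] := pselect (E z); last by exists 0.
  have [c] := Ee z Ez; rewrite Ej => -[[k Kk <-] _] kz.
  exists k => _; split=> // i; apply: le_trans kz.
  by have := coord_le_edist (lam *: (k - x0)) z i; rewrite !mxE.
have [h hh] := choice ex.
(* [U] is the side of a level [m + n] cell after magnification by [lam]. *)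
pose U := lam * 2 ^- (m + n).
have eU : 2 * e <= U.
  have -> : U = 2 * (lam * 2 ^- (m + n).+1).
    by rewrite /U exprS invfM mulrCA mulVKf.
  rewrite ler_pM2l // (le_trans (ltW ee)) //.
  apply: le_trans (_ : 2 ^+ s * 2 ^- (s + (L + n).+1) <= _).
    by rewrite exprD invfM mulVKf ?expf_neq0.
  apply: ler_pM => //; rewrite ?exprn_ge0 ?invr_ge0 ?exprn_ge0 //.
  by rewrite lef_pV2 ?posrE ?exprn_gt0 // ler_weXn2l ?ler1n // addnS ltnS addnA leq_add2r.
pose Rr := lam * 2 ^- m.+1; pose r := lam * 2 ^- (m.+1 + n0).
have r0 : 0 < r by rewrite mulr_gt0 // invr_gt0 exprn_gt0.
have rR : r <= Rr.
  by rewrite ler_pM2l // lef_pV2 ?posrE ?exprn_gt0 // ler_weXn2l ?ler1n // leq_addr.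
have R1 : Rr < 1.
  rewrite ltr_pdivrMr ?exprn_gt0 // mul1r (lt_le_trans s2) //.
  apply: ler_weXn2l; rewrite ?ler1n ?ltnS //.
have RrE : Rr / r = 2 ^+ n0.
  have -> : Rr = 2 ^+ n0 * r by rewrite /r exprD invfM mulrC -!mulrA mulVf ?mulr1 ?expf_neq0.
  by rewrite mulfK // lt0r_neq0.
have rE : r = 2 ^+ d * (U + U).
  rewrite [U + U](_ : _ = 2 * U); last by ring.
  rewrite /U /n (_ : m + (n0 + d.+2) = (m.+1 + n0) + d.+1)%N; last by rewrite addnA addSn !addnS.
  by rewrite mulrA -exprSr mulrC exprD invfM -!mulrA mulVf ?mulr1 ?expf_neq0.
have [Ex hx] := hh x (FE x Fx).
have [f hf] := cantor_prod_near_code m n Ex.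
(* After magnification the distance is at most [Rr + 2 * e <= Rr + U <= 2 * Rr], which is
   [lam * 2 ^- m]. *)
have near y i : F y -> cball x Rr y -> `|h y ord0 i - h x ord0 i| <= 2 ^- m.
  move=> Fy By; have [_ hy] := hh y (FE y Fy).
  have h1 := coord_triangle lam0 (hy i) (hx i).
  have h2 := le_trans (coord_le_edist x y i) By.
  have Rr2 : lam * 2 ^- m = Rr + Rr.
    have -> : Rr + Rr = 2 * Rr by ring.
    by rewrite /Rr exprS invfM mulrCA mulVKf.
  have UR : U <= Rr.
    rewrite ler_pM2l // lef_pV2 ?posrE ?exprn_gt0 // ler_weXn2l ?ler1n //.
    by rewrite /n !addnS ltnS leqW // leq_addr.
  rewrite -(ler_pM2l lam0) -{1}(ger0_norm (ltW lam0)) -normrM Rr2 -[_ * _](subrK (y ord0 i - x ord0 i)).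
  apply: le_trans (ler_normD _ _) _; apply: lerD; last by rewrite distrC.
  by apply: le_trans h1 _; apply: le_trans UR.
have cov : (Ncov r (cball x Rr `&` F) <= (5 ^+ d)%:E)%E.
  apply: le_trans (Ncov_le (f := f \o h) _) _; last first.
    by rewrite card_ffun !card_ord gap muln1 natrX.
  move=> y z [By Fy] [Bz Fz] /= fyz.
  have [Ky hy] := hh y (FE y Fy); have [Kz hz] := hh z (FE z Fz).
  rewrite rE; apply: edist_le => [|i]; first by rewrite addr_ge0 // ltW // (lt_le_trans _ eU) // mulr_gt0.
  have h1 := coord_triangle lam0 (hy i) (hz i).
  have := hf _ _ Ky Kz (fun i => near y i Fy By) (fun i => near z i Fz Bz) fyz i.
  rewrite -(ler_pM2l lam0) -{1}(ger0_norm (ltW lam0)) -normrM -/U => h2.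
  rewrite -[_ - _](subKr (lam * (h y ord0 i - h z ord0 i))).
  apply: le_trans (ler_normB _ _) _; apply: lerD => //.
  exact: le_trans eU.
have := le_trans (hC r Rr x r0 rR R1 Fx) cov.
rewrite lee_fin RrE -powR_mulrn // -powRrM leNgt => /negP; apply.
by move: hn0; rewrite ltr_pdivrMr // mulrC [a * _]mulrC.
Qed.

(** No positive exponent is admissible, so the convention for an empty supremum gives 0; [E] itself
    keeps the outer supremum from being [-oo]. *)
Lemma dimML_microset (E : set 'rV[R]_d) : microset K E -> dimML E = (0 : R)%:E.
Proof.
move=> micE.
have dimL0 (F : set 'rV[R]_d) : F !=set0 -> F `<=` E -> dimL F = (0 : R)%:E.
  move=> F0 FE; rewrite /dimL (_ : [set a | _] = set0) ?image_set0 ?ereal_sup0 ?maxeNy //.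
  by apply/seteqP; split=> // a [a0 /(microset_not_lower_cond micE F0 FE a0)].
have E0 : E !=set0 by case: micE => _ [].
apply/eqP; rewrite eq_le; apply/andP; split.
  by apply: ge_ereal_sup => _ [F [F0 FE] <-]; rewrite dimL0.
by apply: ereal_sup_ubound; exists E; [split|rewrite dimL0].
Qed.

End Microsets.

(** * Conclusion, with density [theta = alpha / d] *)

Theorem theorem2p3 (R : realType) (d : nat) (alpha : R) :
  0 <= alpha -> alpha < d%:R ->
  exists K : set 'rV[R]_d,
    compact K /\ K !=set0 /\ dimA K = alpha%:E /\
    (forall E : set 'rV[R]_d, microset K E -> dimML E = (0:R)%:E).
Proof.
move=> a0 ad; have dR : 0 < d%:R :> R by apply: le_lt_trans ad.
have [||S [gaps upper lower]] := @sparse_set_exists R (alpha / d%:R).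
- by rewrite divr_ge0.
- by rewrite ltr_pdivrMr // mul1r.
exists (cantor_prod S (d := d)); split; first exact: compact_cantor_prod.
split; first by exists 0 => i; rewrite mxE; apply: cantor0.
split; last by move=> E; apply: dimML_microset.
rewrite (dimA_cantor_prod _ _ upper lower) ?divr_ge0 //; last by rewrite -(ltr0n R).
by rewrite divfK // lt0r_neq0.
Qed.
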